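(* Let $\mathrm{Cr}_n$ denote the number of crossings in a uniform random pair partition of the set $[2n]=\{1,\dots,2n\}$. Then, in distribution as $n\to\infty$, $$\frac{\mathrm{Cr}_n-\mathbb{E}\,\mathrm{Cr}_n}{\sqrt{\operatorname{Var}(\mathrm{Cr}_n)}}\to\mathcal{N}(0,1).$$
   Context: A pair partition of $[2n]$ is a set $H$ of disjoint $2$-element subsets of $[2n]$ whose union is $[2n]$. A crossing in a pair partition $H$ is a quadruple $(i,j,k,l)$ with $i<j<k<l$ such that $\{i,k\}$ and $\{j,l\}$ belong to $H$. *)

(* Defs.v *)
From HB Require Import structures.
From mathcomp Require Import all_boot all_order all_algebra.
From mathcomp Require Import all_classical all_reals all_analysis.
From mathcomp Require Import measurable_realfun.

Set Implicit Arguments.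
Unset Strict Implicit.
Unset Printing Implicit Defensive.

Import Order.TTheory GRing.Theory Num.Theory.
Import numFieldNormedType.Exports.

Local Open Scope classical_set_scope.
Local Open Scope ring_scope.

(* The ground set {1, ..., 2n} is represented by the ordinals {0, ..., 2n-1};
   the shift by one preserves the order, hence the crossings. *)
Definition is_pair_partition (n : nat) (H : {set {set 'I_(2 * n)}}) : bool :=
  finset.partition H [set: 'I_(2 * n)]%SET && [forall B in H, #|B| == 2%N].

Record pair_partition (n : nat) := PairPartition {
  blocks :> {set {set 'I_(2 * n)}};
  _ : is_pair_partition blocks
}.

HB.instance Definition _ n := [isSub for @blocks n].
HB.instance Definition _ n := [Finite of pair_partition n by <:].

(* The pair partition {{1,2}, {3,4}, ..., {2n-1,2n}}: a measurableType has to be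
   inhabited. *)
Definition adjacent_pairs (n : nat) : {set {set 'I_(2 * n)}} :=
  preim_partition (fun i : 'I_(2 * n) => i./2) [set: 'I_(2 * n)]%SET.

Lemma adjacent_pairsP (n : nat) : is_pair_partition (adjacent_pairs n).
Proof.
apply/andP; split; first exact: preim_partitionP.
apply/forallP => B; apply/implyP => /imsetP[i _ ->].
have i2n : (i./2 < n)%N by case: i => m /=; rewrite mul2n -ltn_half_double.
have h0 : ((i./2).*2 < 2 * n)%N by rewrite [ltnRHS]mul2n ltn_double.
have h1 : ((i./2).*2.+1 < 2 * n)%N by rewrite [ltnRHS]mul2n ltn_Sdouble.
rewrite (_ : [set y in _ | _]%SET = [set Ordinal h0; Ordinal h1]%SET).
  by rewrite cards2 -val_eqE /= neq_ltn ltnSn.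
apply/setP => j; rewrite !inE -!val_eqE /=.
apply/eqP/orP => [->|[] /eqP ->]; last 2 first.
- by rewrite doubleK.
- exact/esym/(half_bit_double _ true).
rewrite -{1 3}(odd_double_half j); case: (odd j); last by left.
by right.
Qed.

HB.instance Definition _ n :=
  isPointed.Build (pair_partition n) (PairPartition (adjacent_pairsP n)).

HB.instance Definition _ n := @isMeasurable.Build default_measure_display
  (pair_partition n) discrete_measurable discrete_measurable0
  discrete_measurableC discrete_measurableU.

(* The second argument of mnormalize is a default value for measures of mass 0
   or +oo; it is irrelevant here, see uniform_pair_partitionE. *)
Definition uniform_pair_partition (R : realType) (n : nat) :
    probability (pair_partition n) R :=
  mnormalize (@counting (pair_partition n) R) (\d_ point).

Lemma uniform_pair_partitionE (R : realType) (n : nat)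
    (A : {set pair_partition n}) :
  uniform_pair_partition R n [set` A] =
  (#|A|%:R / #|{: pair_partition n}|%:R)%:E.
Proof.
have cnt (B : {set pair_partition n}) :
    @counting (pair_partition n) R [set` B] = #|B|%:R%:E.
  have finB : finite_set [set` B] by exact: finite_finset.
  rewrite /counting asboolT// cardE; congr (_%:R%:E).
  apply/perm_size/uniq_perm; rewrite ?fset_uniq ?enum_uniq// => H.
  by rewrite mem_enum in_fset_set//; apply/idP/idP => [HB|HB]; [exact: (set_mem HB) | exact: mem_set].
have cntT : @counting (pair_partition n) R [set: pair_partition n] =
    #|{: pair_partition n}|%:R%:E.
  rewrite -cardsT -cnt; congr counting.
  by apply/seteqP; split => // H _ /=; rewrite inE.
have card_gt0 : (0 < #|{: pair_partition n}|)%N by apply/card_gt0P; exists point.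
rewrite /uniform_pair_partition /= /mnormalize/= cntT.
by rewrite eqe pnatr_eq0 eqn0Ngt card_gt0 /= cnt -EFinM.
Qed.

(* Each crossing i < j < k < l, with {i, k} and {j, l} in H, is counted once. *)
Definition crossings (n : nat) (H : pair_partition n) : nat :=
  #|[set q : 'I_(2 * n) * 'I_(2 * n) * 'I_(2 * n) * 'I_(2 * n) |
      let: (i, j, k, l) := q in
      [&& (i < j)%N, (j < k)%N, (k < l)%N,
          [set i; k]%SET \in blocks H & [set j; l]%SET \in blocks H]]%SET|.

Definition Cr (R : realType) (n : nat) (H : pair_partition n) : R :=
  (crossings H)%:R.
Arguments Cr R n H : clear implicits.

Lemma measurable_Cr (R : realType) (n : nat) :
  measurable_fun [set: pair_partition n] (Cr R n).
Proof. by []. Qed.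

HB.instance Definition _ (R : realType) (n : nat) :=
  isMeasurableFun.Build _ _ _ _ (Cr R n) (@measurable_Cr R n).

Definition standardize (d : measure_display) (T : measurableType d)
    (R : realType) (P : probability T R) (X : {RV P >-> R}) : T -> R :=
  fun t => (X t - fine 'E_P[X]) / Num.sqrt (fine (variance P X)).
Arguments standardize {d T R} P X.

Lemma measurable_standardize (d : measure_display) (T : measurableType d)
    (R : realType) (P : probability T R) (X : {RV P >-> R}) :
  measurable_fun [set: T] (standardize P X).
Proof.
rewrite /standardize; apply: measurable_funM => //.
by apply: measurable_funB.
Qed.

HB.instance Definition _ (d : measure_display) (T : measurableType d)
    (R : realType) (P : probability T R) (X : {RV P >-> R}) :=
  isMeasurableFun.Build _ _ _ _ (@standardize d T R P X)
    (@measurable_standardize d T R P X).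

(* Convergence in distribution of real random variables, possibly defined on
   different probability spaces, to a law mu: the distribution functions converge
   at every continuity point of the distribution function of mu. *)
Definition cvg_in_distribution (R : realType) (d : nat -> measure_display)
    (T : forall n, measurableType (d n)) (P : forall n, probability (T n) R)
    (X : forall n, {RV P n >-> R}) (mu : probability (measurableTypeR R) R) : Prop :=
  forall x : R, {for x, continuous (fun y : R => mu `]-oo, y]%classic)} ->
    cdf (X n) x @[n --> \oo] --> mu `]-oo, x]%classic.
Arguments cvg_in_distribution {R d T} P X mu.

(* Main.v *)
Require Import Defs.
From HB Require Import structures.
From mathcomp Require Import all_boot all_order all_algebra.
From mathcomp Require Import all_classical all_reals all_analysis.
From mathcomp Require Import zify ring lra.

(** Read the [2n] points from left to right.  When [h] chords are open and [r]
    chords have not been started, the next point of a uniform matching closes an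
    open chord with probability [h / (h + 2r)]; which of the [h] chords it closes
    is uniform, and closing the one that has [j] open chords started after it
    creates exactly [j] crossings.  So the crossing number is the terminal value
    of an additive functional of a Markov chain on pairs [(h, r)]
    ([sum_partial_matching], [crossing_sumE], [avg_crossings]).

    In the state [(h, r)] the number of crossings still to come has mean
    [mean_cr h r] and variance [var_cr h r], explicit polynomials of degree 2
    and 3.  That they are the mean and the variance is equivalent to two
    identities about a single step ([jump_centered], [jump_variance]); at
    [(0, n)] they give the expectation and the variance [n (n-1) (n+3) / 45].

    Having the exact conditional variance at every state replaces the usual
    study of the quadratic variation of the martingale.  Let
    [heat y w = Phi (y / sqrt w)], with [Phi] the normal distribution function,
    which solves the heat equation [d/dw = 1/2 d^2/dy^2].  Evaluate it at
    [y = x - (predicted standardized crossing number)] and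
    [w = w0 + (remaining variance) / var_cr 0 n].  One step of the chain changes
    [y] by a centered amount of order [n^(-1/2)] and [w] by an amount of order
    [1/n] whose mean compensates the mean square of the change of [y]; hence
    the conditional expectation changes by [O(n^(-3/2))] only ([heat_step]).
    Over the [2n] steps this adds up to [O(n^(-1/2))] ([heat_gauss_approx],
    [heat_avg_cvg]): the expectation of [Phi ((x - X_n) / sqrt w0)] tends to
    [Phi (x / sqrt (w0 + 1))].  With [w0 = e^2] small, [Phi ((x - X) / e)] is a
    smooth step function, and shifting it by [L e] to either side encloses the
    indicator of [X <= x] up to the tails of [Phi] beyond [L]
    ([indicator_le_heat], [heat_le_indicator]). *)

Set Implicit Arguments.
Unset Strict Implicit.
Unset Printing Implicit Defensive.

Import Order.TTheory GRing.Theory Num.Theory.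

Local Open Scope ring_scope.

(** * Sweeping the points: a recursion for the crossing statistic *)

(** [crossing_sum h m g] is the sum of [g (number of crossings created)] over all
    ways to match [m] remaining points among themselves and with [h] open chords.
    The first remaining point either opens a chord or closes the open chord that
    has [j] open chords started after it; the latter creates [j] crossings. *)
Fixpoint crossing_sum (V : nmodType) (h m : nat) (g : nat -> V) : V :=
  if m is m'.+1 then
    crossing_sum h.+1 m' g +
    \sum_(j < h) crossing_sum h.-1 m' (fun x => g (j + x)%N)
  else if h == 0%N then g 0%N else 0.

Section Matchings.
Import boot.ssrnat boot.fintype boot.finset boot.bigop.
Local Open Scope nat_scope.
Local Open Scope set_scope.
Variable N : nat.
Implicit Types (A B D : {set 'I_N}) (H : {set {set 'I_N}}) (a b x y : 'I_N).

Definition crossing_set H : {set 'I_N * 'I_N * 'I_N * 'I_N} :=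
  [set q : 'I_N * 'I_N * 'I_N * 'I_N | let: (i, j, k, l) := q in
    [&& i < j, j < k, k < l, [set i; k] \in H & [set j; l] \in H]].

(** The points of [A] are the left ends of the open chords: the condition
    [~~ (D \subset A)] says that no two of them are joined. *)
Definition partial_matching A B H :=
  partition H (A :|: B) && [forall D in H, (#|D| == 2) && ~~ (D \subset A)].

Definition precedes A B := forall a b, a \in A -> b \in B -> a < b.

Lemma partial_matchingP A B H :
  reflect (partition H (A :|: B) /\
           forall D, D \in H -> #|D| = 2 /\ ~~ (D \subset A))
          (partial_matching A B H).
Proof.
apply: (iffP andP) => -[pH hH]; split => //.
  by move=> D DH; have /implyP/(_ DH)/andP[/eqP] := forallP hH D.
by apply/forallP => D; apply/implyP => /hH[-> ->].
Qed.

Lemma block_eq H D B1 B2 x : partition H D ->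
  B1 \in H -> B2 \in H -> x \in B1 -> x \in B2 -> B1 = B2.
Proof.
move=> /partition_trivIset tH B1H B2H x1 x2.
by rewrite -(def_pblock tH B1H x1) (def_pblock tH B2H x2).
Qed.

Lemma set2_inj a b x y : a < b -> x < y -> [set x; y] = [set a; b] ->
  x = a /\ y = b.
Proof.
move=> ab xy /setP e.
have := e x; have := e y; rewrite !inE !eqxx ?orbT /=.
move=> /esym/orP[]/eqP ? /esym/orP[]/eqP ?; subst; split => //; lia.
Qed.

Lemma card2_set2 D x : x \in D -> #|D| = 2 ->
  exists2 y, y != x & D = [set x; y].
Proof.
move=> xD /eqP/cards2P[u [v [uv E]]]; move: xD; rewrite E !inE.
case/orP => /eqP->; first by exists v => //; rewrite eq_sym.
by exists u => //; rewrite setUC.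
Qed.

(** Closing [a] crosses the open chords started after [a]; over all choices of
    [a] these numbers are [0, ..., #|A| - 1], each taken once. *)
Lemma sum_rank (V : nmodType) A (f : nat -> V) :
  (\sum_(a in A) f #|[set x in A | (a < x)%N]| = \sum_(j < #|A|) f j)%R.
Proof.
move: {2}#|A| (erefl #|A|) => n; elim: n A => [|n IH] A.
  by move=> A0; rewrite A0 (cards0_eq A0) big_set0 big_ord0.
move=> An; have /card_gt0P[a0 a0A] : 0 < #|A| by rewrite An.
case: (arg_minnP (fun i : 'I_N => i : nat) a0A) => a aA0 amin; have {aA0}aA : a \in A by [].
have Aa : #|A :\ a| = n by have := cardsD1 a A; rewrite aA An => -[].
rewrite (big_setD1 a aA) /= An big_ord_recr /= GRing.addrC -Aa -IH //.
congr (_ + f _)%R; last first.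
  apply/eq_card => x; rewrite !inE; have [->|xa] := eqVneq x a; first by lia.
  have [xA|//] := boolP (x \in A); have := amin _ xA.
  move: xa; rewrite -val_eqE /=; lia.
apply: eq_bigr => x; rewrite !inE => /andP[xa xA].
congr f; apply/eq_card => y; rewrite !inE.
have [->|//] := eqVneq y a; have := amin _ xA; rewrite aA /=; lia.
Qed.

Section Step.
Variables (A B : {set 'I_N}) (b : 'I_N).
Hypothesis AB : precedes A B.
Hypothesis bB : b \in B.
Hypothesis bmin : forall x, x \in B -> b <= x.

Let bA : b \notin A.
Proof. by apply/negP => /AB/(_ bB); rewrite ltnn. Qed.

Let UE : (b |: A) :|: (B :\ b) = A :|: B.
Proof.
apply/setP => x; rewrite !inE; have [->|//] := eqVneq x b.
by rewrite bB orbT.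
Qed.

(** The matchings in which [b] is a left end: moving [b] from the remaining
    points to the open ones turns the condition that [b] is not joined to [A]
    into the condition that no block lies inside the open set. *)
Lemma partial_matching_open H : partial_matching (b |: A) (B :\ b) H =
  partial_matching A B H && ~~ [exists a in A, [set a; b] \in H].
Proof.
apply/partial_matchingP/andP; rewrite UE.
  move=> [pH hH]; split.
    apply/partial_matchingP; split => // D /hH[-> DA]; split => //.
    by apply: contraNN DA => /subset_trans; apply; exact: subsetUr.
  apply/negP => /existsP[a /andP[aA /hH[_ /negP[]]]].
  by apply/subsetP => x; rewrite !inE => /orP[]/eqP->; rewrite ?eqxx ?aA ?orbT.
move=> [/partial_matchingP[pH hH] /negP nex]; split => // D DH.
have [D2 DA] := hH _ DH; split => //; apply/negP => DbA.
have [bD|bD] := boolP (b \in D).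
  have [a ab E] := card2_set2 bD D2; apply: nex; apply/existsP; exists a.
  rewrite setUC -E DH andbT; have /subsetP/(_ a) := DbA.
  by rewrite E !inE eqxx orbT (negPf ab) /=; apply.
case/negP: DA; apply/subsetP => x xD; have /subsetP/(_ _ xD) := DbA.
by rewrite !inE; case/orP => // /eqP xb; rewrite -xb xD in bD.
Qed.

Variable a : 'I_N.
Hypothesis aA : a \in A.

Let ab : a < b. Proof. exact: AB. Qed.
Let aB : a \notin B. Proof. by apply/negP => /(AB aA); rewrite ltnn. Qed.
Let a_neq_b : a != b. Proof. by rewrite -val_eqE /= neq_ltn ab. Qed.

Let DE : (A :|: B) :\: [set a; b] = (A :\ a) :|: (B :\ b).
Proof.
apply/setP => x; rewrite !inE; have [->|_] := eqVneq x a.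
  by rewrite (negPf aB) andbF.
by have [->|_] := eqVneq x b; rewrite ?(negPf bA).
Qed.

Let abS : [set a; b] \subset A :|: B.
Proof. by apply/subsetP => x; rewrite !inE => /orP[]/eqP->; rewrite ?aA ?bB ?orbT. Qed.

Lemma partial_matching_closeD H : partial_matching A B H -> [set a; b] \in H ->
  partial_matching (A :\ a) (B :\ b) (H :\ [set a; b]).
Proof.
move=> /partial_matchingP[pH hH] abH; apply/partial_matchingP; split.
  by rewrite -DE; exact: partitionD1.
move=> D; rewrite inE => /andP[_ /hH[-> DA]]; split => //.
by apply: contraNN DA => /subset_trans; apply; exact: subsetDl.
Qed.

Lemma notin_close H : partial_matching (A :\ a) (B :\ b) H ->
  [set a; b] \notin H.
Proof.
move=> /partial_matchingP[pH _]; apply/negP => /(partitionS pH)/subsetP/(_ a).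
by rewrite !inE !eqxx (negPf aB) andbF; move/(_ isT).
Qed.

Lemma partial_matching_closeU H : partial_matching (A :\ a) (B :\ b) H ->
  partial_matching A B ([set a; b] |: H).
Proof.
move=> /[dup] mH /partial_matchingP[pH hH]; apply/partial_matchingP; split.
  rewrite -(setID (A :|: B) [set a; b]) DE (setIidPr abS).
  apply: partitionU1 => //; first by apply/set0Pn; exists a; rewrite !inE eqxx.
  by rewrite -DE disjoint_sym disjoints_subset; apply/subsetP => x; rewrite !inE => /andP[].
move=> D; rewrite !inE => /orP[/eqP->|DH].
  rewrite cards2 a_neq_b; split => //; apply/negP => /subsetP/(_ b).
  by rewrite !inE eqxx orbT (negPf bA); move/(_ isT).
have [-> DA] := hH _ DH; split => //; apply: contraNN DA => DA.
apply/subsetP => x xD; rewrite !inE (subsetP DA _ xD) andbT.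
apply/eqP => xa; have /subsetP/(_ _ xD) := partitionS pH DH.
by rewrite xa !inE eqxx (negPf aB) andbF.
Qed.

(** Everything to the left of [b] is open, so the chords that cross [{a, b}] are
    exactly those that start in [A] after [a]: they end after [b], because two
    open points are never joined.  No chord starting before [a] can end between
    [a] and [b]. *)
Lemma crossing_set_close H : partial_matching (A :\ a) (B :\ b) H ->
  #|crossing_set ([set a; b] |: H)| =
  #|[set x in A | a < x]| + #|crossing_set H|.
Proof.
move=> /[dup] mH /partial_matchingP[pH hH].
have inAB D x : D \in H -> x \in D -> (x \in A :\ a) || (x \in B :\ b).
  by move=> DH xD; have /subsetP/(_ _ xD) := partitionS pH DH; rewrite inE.
have lowA D x : D \in H -> x \in D -> x < b -> (x \in A) && (x != a).
  move=> DH xD xb; have := inAB _ _ DH xD; rewrite !inE.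
  case/orP => /andP[]; first by move=> -> ->.
  by move=> _ /bmin; rewrite leqNgt xb.
(* the crossings that involve the block {a, b} *)
pose new := [set q in crossing_set ([set a; b] |: H) | q \notin crossing_set H].
have newE q : q \in new = [&& q.1.1.1 == a, q.1.2 == b, a < q.1.1.2,
    q.1.1.2 < b, b < q.2 & [set q.1.1.2; q.2] \in H].
  case: q => [[[i j] k] l]; rewrite !inE /=; apply/idP/idP.
    case/andP => /and5P[ij jk kl + +] nH.
    case/orP => [/eqP ik|ikH].
      have [ia kb] := set2_inj ab (ltn_trans ij jk) ik; subst i k.
      rewrite !eqxx ij jk kl /=; case/orP => [/eqP jl|->//].
      by have [ja lb] := set2_inj ab (ltn_trans jk kl) jl; move: ij; rewrite ja ltnn.
    case/orP => [/eqP jl|jlH]; last by move: nH; rewrite ij jk kl ikH jlH.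
    have [ja lb] := set2_inj ab (ltn_trans jk kl) jl; subst j l.
    have /negP[] := (hH _ ikH).2; apply/subsetP => x xik.
    have xb : x < b.
      by move: xik; rewrite !inE => /orP[]/eqP-> //; exact: ltn_trans (ltn_trans ij jk) kl.
    by rewrite !inE andbC; exact: lowA ikH xik xb.
  case/and5P => /eqP-> /eqP-> aj jb /andP[bl jlH].
  rewrite aj jb bl jlH eqxx orbT /= andbT; apply/negP => abH.
  by have /negP := notin_close mH.
have -> : crossing_set ([set a; b] |: H) = new :|: crossing_set H.
  apply/setP => q; rewrite [RHS]inE [q \in new]inE.
  have [qH|//] := boolP (q \in crossing_set H); last by rewrite orbF andbT.
  rewrite orbT; move: q qH => [[[i j] k] l]; rewrite !inE.
  by move=> /and5P[-> -> -> -> ->]; rewrite !orbT.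
rewrite cardsU (_ : new :&: _ = set0) ?cards0 ?subn0; last first.
  by apply/setP => q; rewrite inE [q \in new]inE [RHS]inE; case: (q \in crossing_set H); rewrite ?andbF.
congr (_ + _); rewrite -(@card_in_imset _ _ (fun q => q.1.1.2) new).
  apply: eq_card => x; rewrite [RHS]inE; apply/imsetP/andP.
    case=> q; rewrite newE => /and5P[_ _ aq qb /andP[_ qH]] ->.
    by split => //; have /andP[] := lowA _ q.1.1.2 qH (set21 _ _) qb.
  move=> [xA ax].
  have xD : x \in cover H.
    by rewrite (cover_partition pH) !inE xA andbT -val_eqE /= neq_ltn ax orbT.
  have /bigcupP[D DH xD'] := xD; have [D2 DA] := hH _ DH.
  have [l lx Dl] := card2_set2 xD' D2.
  exists (a, x, b, l) => //; rewrite newE /= !eqxx ax (AB xA bB) -Dl DH andbT /=.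
  have lD : l \in D by rewrite Dl set22.
  have := inAB _ _ DH lD; case/orP => [lA|]; last first.
    by rewrite !inE -val_eqE /= => /andP[lb /bmin]; rewrite ltn_neqAle eq_sym lb.
  case/negP: DA; apply/subsetP => y; rewrite Dl !inE => /orP[]/eqP->.
    by rewrite xA -val_eqE /= neq_ltn ax orbT.
  by move: lA; rewrite !inE.
move=> [[[i j] k] l] [[[i' j'] k'] l'].
rewrite !newE /= => /and5P[/eqP-> /eqP-> _ jb /andP[bl jlH]].
case/and5P => /eqP-> /eqP-> _ _ /andP[bl' jlH'] e; subst j'.
have := block_eq pH jlH jlH' (set21 _ _) (set21 _ _) => /setP/(_ l).
by rewrite !inE eqxx orbT => /esym/orP[]/eqP e; subst => //; have := ltn_trans bl jb; rewrite ltnn.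
Qed.

End Step.

(** The recursion is driven by the first remaining point.  Working with subsets
    of a fixed ground set avoids relabelling the points when a chord is deleted. *)
Theorem sum_partial_matching (V : nmodType) A B (g : nat -> V) :
  precedes A B ->
  (\sum_(H | partial_matching A B H) g #|crossing_set H| =
   crossing_sum #|A| #|B| g)%R.
Proof.
move: {2}#|B| (erefl #|B|) => m; elim: m A B g => [|m IH] A B g Bm AB.
  rewrite Bm (cards0_eq Bm) /= cards_eq0; have [->|A0] := eqVneq A set0.
    rewrite (big_pred1 set0) => [|H].
      rewrite (_ : crossing_set _ = set0) ?cards0 //.
      by apply/setP => -[[[i j] k] l]; rewrite !inE !andbF.
    apply/partial_matchingP/eqP; rewrite setU0.
      by case; rewrite partition_set0 => /eqP.
    by move=> ->; rewrite partition_set0; split => // D; rewrite inE.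
  apply: big_pred0 => H; apply/negP => /partial_matchingP[]; rewrite setU0.
  move=> pH hH; have /set0Pn[a aA] := A0.
  have := aA; rewrite -{1}(cover_partition pH) => /bigcupP[D DH _].
  by have /negP[] := (hH _ DH).2; exact: partitionS pH DH.
have /card_gt0P[b0 b0B] : 0 < #|B| by rewrite Bm.
case: (arg_minnP (fun i : 'I_N => i : nat) b0B) => b bB0 bmin; have {bB0}bB : b \in B by [].
have bm : #|B :\ b| = m by have := cardsD1 b B; rewrite bB Bm => -[].
have bA : b \notin A by apply/negP => /AB/(_ bB); rewrite ltnn.
(* split according to whether b, the first remaining point, closes a chord *)
rewrite Bm /= (bigID (fun H => [exists a in A, [set a; b] \in H])) /=.
rewrite GRing.addrC; congr (_ + _)%R.
  rewrite (_ : #|A|.+1 = #|b |: A|); last by rewrite cardsU1 bA.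
  rewrite -bm -IH // => [|x y]; last first.
    rewrite !inE => /orP[/eqP->|xA] /andP[yb yB]; last exact: AB.
    by rewrite ltn_neqAle eq_sym yb bmin.
  by apply: eq_bigl => H; rewrite partial_matching_open.
rewrite -(sum_rank A (fun j => crossing_sum #|A|.-1 m (fun k => g (j + k)))).
transitivity (\sum_(H | partial_matching A B H)
    \sum_(a in A | [set a; b] \in H) g #|crossing_set H|)%R.
  rewrite big_mkcondr /=; apply: eq_bigr => H /partial_matchingP[pH hH].
  case: ifPn => [/existsP[a /andP[aA abH]]|nex]; last first.
    rewrite big_pred0 // => a; apply/negP => aP.
    by move: nex => /existsP; case; exists a.
  rewrite (big_pred1 a) // => x; apply/andP/eqP => [[xA xH]|->//].
  have := block_eq pH xH abH (set22 _ _) (set22 _ _) => /setP/(_ x).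
  rewrite !inE eqxx /= => /esym/orP[]/eqP // xb.
  by rewrite -xb xA in bA.
rewrite (exchange_big_dep (mem A)) /=; last by move=> H a _ /andP[].
apply: eq_bigr => a aA.
have aA1 : #|A :\ a| = #|A|.-1 by rewrite (cardsD1 a A) aA.
rewrite -aA1 -bm -(IH (A :\ a)) //; last first.
  by move=> x y; rewrite !inE => /andP[_ xA] /andP[_]; exact: AB.
rewrite (reindex_onto (fun H => [set a; b] |: H) (fun H => H :\ [set a; b])) /=; last first.
  by move=> H /andP[_ /andP[_ abH]]; rewrite setD1K.
apply: eq_big => [H|H /andP[/andP[pH _] /eqP e]]; last first.
  rewrite (crossing_set_close AB bB bmin aA) // -e.
  by apply: partial_matching_closeD => //; rewrite setU11.
apply/andP/idP => [[/andP[pH _] /eqP e]|pH].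
  by rewrite -e; apply: partial_matching_closeD => //; rewrite setU11.
rewrite aA setU11 /= andbT; split; first exact: partial_matching_closeU.
by rewrite setU1K // (notin_close AB aA pH).
Qed.

End Matchings.

(** * The Markov chain, its mean and its variance *)

Section Walk.
Variable R : realFieldType.
Implicit Types (g : nat -> R) (h r m x : nat).

(** The expectation of [g (number of crossings to come)] for the chain started
    with [h] open chords and [m] points left: [crossing_sum] divided by the number
    of completions.  The factor [m - h] is twice the number of chords not yet
    started. *)
Fixpoint chain_mean h m g : R :=
  if m is m'.+1 then
    ((m - h)%:R * chain_mean h.+1 m' g +
     \sum_(j < h) chain_mean h.-1 m' (fun x => g (j + x)%N)) / m%:R
  else g 0%N.

(** Each open chord needs a point to end at. *)
Lemma crossing_sum_lt h m g : (m < h)%N -> crossing_sum h m g = 0.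
Proof.
elim: m h g => [|m IH] h g mh /=; first by case: h mh.
rewrite IH ?add0r; last by lia.
by apply: big1 => j _; apply: IH; lia.
Qed.

(** Choose the right ends of the [h] open chords in order, then match the other
    [2r] points: [(h+2r)! / (2r)!] times [(2r)! / (2^r r!)]. *)
Definition completions h r : R := ((h + 2 * r)`!)%:R / (2 ^ r * r`!)%:R.

Lemma crossing_sumE h r m g : (h + 2 * r = m)%N ->
  crossing_sum h m g = completions h r * chain_mean h m g.
Proof.
elim: m h r g => [|m IH] h r g hr /=.
  have [-> ->] : h = 0%N /\ r = 0%N by lia.
  by rewrite /completions fact0 expn0 muln1 divr1 mul1r.
have m0 : m.+1%:R != 0 :> R by rewrite pnatr_eq0.
have cE : completions h r = m.+1%:R * ((m`!)%:R / (2 ^ r * r`!)%:R).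
  by rewrite /completions hr factS natrM mulrA.
rewrite cE [X in X * _]mulrC -mulrA [m.+1%:R * _]mulrC (divfK m0) mulrDr.
congr (_ + _).
  case: r hr {cE} => [|r] hr.
    rewrite crossing_sum_lt; last by lia.
    by rewrite (_ : (m.+1 - h)%N = 0%N) ?mul0r ?mulr0 //; lia.
  rewrite (IH h.+1 r); last by lia.
  rewrite mulrA; congr (_ * _).
  have e1 : (h.+1 + 2 * r)%N = m by lia.
  have e2 : (m.+1 - h = 2 * r.+1)%N by lia.
  rewrite /completions e1 e2.
  rewrite factS expnS !natrM.
  have ? : r.+1%:R != 0 :> R by rewrite pnatr_eq0.
  have ? : (2 ^ r)%:R != 0 :> R by rewrite pnatr_eq0 expn_eq0.
  have ? : (r`!)%:R != 0 :> R by rewrite pnatr_eq0 -lt0n fact_gt0.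
  field.
  by apply/and3P.
rewrite mulr_sumr; apply: eq_bigr => j _.
rewrite (IH _ r); last by have := ltn_ord j; lia.
congr (_ * _); rewrite /completions; congr (_`!%:R / _).
by have := ltn_ord j; lia.
Qed.

Lemma completions_gt0 h r : 0 < completions h r.
Proof. by rewrite divr_gt0 ?ltr0n ?fact_gt0 ?muln_gt0 ?expn_gt0 ?fact_gt0. Qed.

Lemma sum_ord_const h (c : R) : \sum_(j < h) c = h%:R * c.
Proof. by rewrite sumr_const card_ord mulr_natl. Qed.

(** If [psi] is, up to [e] per step, harmonic for the chain with accumulated
    crossing number [x], then it predicts the terminal expectation up to [m * e].
    With [e = 0] this computes moments; with small [e] it is the telescoping
    argument of the central limit theorem. *)
Lemma chain_mean_approx (psi : nat -> nat -> nat -> R) (M : nat) (e : R) :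
  (forall h r x, (0 < h + 2 * r <= M)%N ->
    `|(2 * r)%:R * psi h.+1 r.-1 x + \sum_(j < h) psi h.-1 r (x + j)%N
      - (h + 2 * r)%:R * psi h r x| <= (h + 2 * r)%:R * e) ->
  forall m h r x, (h + 2 * r = m)%N -> (m <= M)%N ->
  `|chain_mean h m (fun k => psi 0%N 0%N (x + k)%N) - psi h r x| <= m%:R * e.
Proof.
move=> step; elim=> [|m IH] h r x hr mM /=.
  have [-> ->] : h = 0%N /\ r = 0%N by lia.
  by rewrite addn0 subrr normr0 mul0r.
have m0 : 0 < m.+1%:R :> R by rewrite ltr0n.
rewrite -[X in _ - X](mulfK (lt0r_neq0 m0)) -mulrBl normrM normfV.
rewrite (gtr0_norm m0) ler_pdivrMr //.
have -> : (m.+1 - h = 2 * r)%N by lia.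
pose c1 := chain_mean h.+1 m (fun k => psi 0%N 0%N (x + k)%N).
pose c2 (j : nat) := chain_mean h.-1 m (fun k => psi 0%N 0%N (x + (j + k))%N).
have H1 : `|(2 * r)%:R * (c1 - psi h.+1 r.-1 x)| <= (2 * r)%:R * (m%:R * e).
  rewrite normrM ger0_norm //; have [->|r0] := eqVneq r 0%N.
    by rewrite muln0 !mul0r.
  by apply: ler_wpM2l => //; apply: IH; lia.
have H2 : `|\sum_(j < h) (c2 j - psi h.-1 r (x + j)%N)| <= h%:R * (m%:R * e).
  apply: le_trans (ler_norm_sum _ _ _) _.
  apply: le_trans (_ : \sum_(j < h) m%:R * e <= _); last first.
    by rewrite sum_ord_const.
  apply: ler_sum => j _; rewrite /c2.
  under [X in chain_mean _ _ X]eq_fun do rewrite addnA.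
  by apply: IH; have := ltn_ord j; lia.
have H3 := step h r x ltac:(lia); rewrite hr in H3.
rewrite [X in `|X|](_ : _ =
  ((2 * r)%:R * psi h.+1 r.-1 x + \sum_(j < h) psi h.-1 r (x + j)%N
      - m.+1%:R * psi h r x) + (2 * r)%:R * (c1 - psi h.+1 r.-1 x) +
  \sum_(j < h) (c2 j - psi h.-1 r (x + j)%N)); last by rewrite sumrB /c1 /c2; ring.
apply: le_trans (ler_normD _ _) _; apply: le_trans (lerD (ler_normD _ _) (lexx _)) _.
apply: le_trans (lerD (lerD H3 H1) H2) _.
have hrE : m.+1%:R = (2 * r)%:R + h%:R :> R by rewrite -natrD addnC hr.
have mE : m%:R = (2 * r)%:R + h%:R - 1 :> R by rewrite -hrE -natr1 addrK.
rewrite hrE.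
by rewrite mE le_eqVlt; apply/orP; left; apply/eqP; ring.
Qed.

(** Two open chords cross with probability 1/2, an open chord and a new one with
    probability 1/3, two new chords with probability 1/3. *)
Definition mean_cr (a b : R) : R := a * (a - 1) / 4 + a * b / 3 + b * (b - 1) / 6.

(** Whether two chords cross is independent of whether two others do, so only
    pairs of pairs with a common chord contribute to the variance; it is a
    polynomial of degree 3, determined by its first values.  For [b = 0] it is the
    variance of the number of inversions of a random permutation. *)
Definition var_cr (a b : R) : R :=
  a * (a - 1) * (2 * a + 5) / 72 + a ^+ 2 * b / 18 + a * b ^+ 2 / 15
  + a * b / 10 + b * (b - 1) * (b + 3) / 45.

(** The change of the predicted total number of crossings when a chord is opened,
    respectively when the chord with [j] later open chords is closed. *)
Definition open_jump (a : R) : R := a / 6.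
Definition close_jump (a b j : R) : R := j - (a - 1) / 2 - b / 3.

Lemma mean_cr_open a b : mean_cr (a + 1) (b - 1) = mean_cr a b + open_jump a.
Proof. by rewrite /mean_cr /open_jump; field. Qed.

Lemma mean_cr_close a b j :
  j + mean_cr (a - 1) b = mean_cr a b + close_jump a b j.
Proof. by rewrite /mean_cr /close_jump; field. Qed.

Lemma sum_ord_nat h : \sum_(j < h) (j : nat)%:R = h%:R * (h%:R - 1) / 2 :> R.
Proof.
elim: h => [|h IH]; first by rewrite big_ord0 !mul0r.
by rewrite big_ord_recr /= IH -natr1; field.
Qed.

Lemma sum_ord_nat2 h :
  \sum_(j < h) (j : nat)%:R ^+ 2 = h%:R * (h%:R - 1) * (2 * h%:R - 1) / 6 :> R.
Proof.
elim: h => [|h IH]; first by rewrite big_ord0 !mul0r.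
by rewrite big_ord_recr /= IH -natr1; field.
Qed.

Lemma jump_centered h (b : R) :
  2 * b * open_jump h%:R + \sum_(j < h) close_jump h%:R b j%:R = 0.
Proof.
rewrite /close_jump /open_jump !sumrB sum_ord_nat !sum_ord_const.
by field.
Qed.

(** The law of total variance for one step, multiplied by the number of remaining
    points. *)
Lemma jump_variance h (b : R) :
  2 * b * (open_jump h%:R ^+ 2 + (var_cr (h%:R + 1) (b - 1) - var_cr h%:R b)) +
  \sum_(j < h) (close_jump h%:R b j%:R ^+ 2 + (var_cr (h%:R - 1) b - var_cr h%:R b))
  = 0.
Proof.
pose a : R := h%:R.
transitivity (2 * b * (open_jump a ^+ 2 + (var_cr (a + 1) (b - 1) - var_cr a b)) +
   (\sum_(j < h) (j : nat)%:R ^+ 2 - 2 * ((a - 1) / 2 + b / 3) * (\sum_(j < h) (j : nat)%:R)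
    + a * (((a - 1) / 2 + b / 3) ^+ 2 + (var_cr (a - 1) b - var_cr a b)))).
  congr (_ + _); rewrite -(sum_ord_const h (_ ^+ 2 + _)) mulr_sumr -sumrB -big_split /=.
  by apply: eq_bigr => j _; rewrite /close_jump; field.
by rewrite sum_ord_nat sum_ord_nat2 /open_jump /var_cr -/a; field.
Qed.

(** [chain_mean_approx] in the coordinates used below: [y] is the predicted total
    number of crossings and [w] the remaining variance, so that a prediction at
    [(0, n)] becomes exact information, with [w = 0], at the end. *)
Lemma chain_mean_jump (f : R -> R -> R) (M : nat) (e : R) :
  (forall h r (y : R), (0 < h + 2 * r <= M)%N ->
    let a := h%:R in let b := r%:R in let w := var_cr a b in
    `|(2 * b) * (f (y + open_jump a) (var_cr (a + 1) (b - 1)) - f y w) +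
     \sum_(j < h) (f (y + close_jump a b j%:R) (var_cr (a - 1) b) - f y w)|
      <= (h + 2 * r)%:R * e) ->
  forall n x, (2 * n <= M)%N ->
  `|chain_mean 0 (2 * n) (fun k => f (x + k)%:R 0) -
    f (x%:R + mean_cr 0 n%:R) (var_cr 0 n%:R)| <= (2 * n)%:R * e.
Proof.
move=> step n x nM.
pose psi h r x := f (x%:R + mean_cr h%:R r%:R) (var_cr h%:R r%:R).
have psi0 k : psi 0%N 0%N k = f k%:R 0.
  by rewrite /psi /mean_cr /var_cr; congr f; ring.
under [X in chain_mean _ _ X]eq_fun do rewrite -psi0.
apply: (@chain_mean_approx psi M e) => {n x nM psi0} // h r x hr.
pose a : R := h%:R; pose b : R := r%:R; pose y := x%:R + mean_cr a b.
have E1 : 2 * b * f (y + open_jump a) (var_cr (a + 1) (b - 1)) =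
    (2 * r)%:R * psi h.+1 r.-1 x.
  rewrite natrM /y /b; case: (r) => [|r']; first by rewrite mulr0 !mul0r.
  by rewrite /psi /a -addrA -mean_cr_open -(natr1 h) -(natr1 r') addrK.
have E2 : \sum_(j < h) f (y + close_jump a b j%:R) (var_cr (a - 1) b) =
    \sum_(j < h) psi h.-1 r (x + j)%N.
  have close (j : nat) : (0 < h)%N ->
      f (y + close_jump a b j%:R) (var_cr (a - 1) b) = psi h.-1 r (x + j)%N.
    rewrite /psi /y /a; case: (h) => // h' _.
    by rewrite -addrA -mean_cr_close -(natr1 h') addrK addrA -natrD.
  by apply: eq_bigr => j _; apply: close; have := ltn_ord j; lia.
have /= := step h r y hr; rewrite -/a -/b mulrBr E1 sumrB E2 sum_ord_const.
rewrite (_ : (h + 2 * r)%:R * psi h r x = 2 * b * f y (var_cr a b) + a * f y (var_cr a b)).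
  by congr (`|_| <= _); ring.
by rewrite natrD natrM -mulrDl addrC.
Qed.

Lemma chain_mean_id n : chain_mean 0 (2 * n) (fun k => k%:R) = mean_cr 0 n%:R.
Proof.
have := @chain_mean_jump (fun y _ => y) (2 * n) 0 _ n 0 (leqnn _).
rewrite mulr0 normr_le0 subr_eq0 add0r => H; apply/eqP/H => h r y _ /=.
rewrite addrAC subrr add0r (eq_bigr (fun j : 'I_h => close_jump h%:R r%:R j%:R)).
  by rewrite jump_centered normr0 mulr0.
by move=> j _; rewrite addrAC subrr add0r.
Qed.

Lemma chain_mean_sqr n c :
  chain_mean 0 (2 * n) (fun k => (k%:R - c) ^+ 2) =
  (mean_cr 0 n%:R - c) ^+ 2 + var_cr 0 n%:R.
Proof.
have := @chain_mean_jump (fun y w => (y - c) ^+ 2 + w) (2 * n) 0 _ n 0 (leqnn _).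
rewrite mulr0 normr_le0 subr_eq0 add0r => H.
transitivity (chain_mean 0 (2 * n) (fun k => (k%:R - c) ^+ 2 + 0)).
  by congr chain_mean; apply/funext => k; rewrite addr0.
apply/eqP/H => {H} h r y _ /=.
set a := h%:R; set b := r%:R.
rewrite (eq_bigr (fun j : 'I_h => 2 * (y - c) * close_jump a b j%:R +
   (close_jump a b j%:R ^+ 2 + (var_cr (a - 1) b - var_cr a b)))); last first.
  by move=> j _; ring.
rewrite big_split /= -mulr_sumr.
rewrite (_ : _ + _ = 2 * (y - c) * (2 * b * open_jump a + \sum_(j < h) close_jump a b j%:R)
  + (2 * b * (open_jump a ^+ 2 + (var_cr (a + 1) (b - 1) - var_cr a b)) +
  \sum_(j < h) (close_jump a b j%:R ^+ 2 + (var_cr (a - 1) b - var_cr a b)))); last by ring.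
by rewrite jump_centered jump_variance !mulr0 addr0 normr0.
Qed.

Lemma var_cr_ge0 h r : 0 <= var_cr h%:R r%:R.
Proof.
have sub1 (k : nat) : 0 <= k%:R * (k%:R - 1) :> R.
  by case: k => [|k]; rewrite ?mul0r // mulr_ge0 // -natr1 addrK.
rewrite /var_cr; repeat apply: addr_ge0; rewrite divr_ge0 //.
- by apply: mulr_ge0 (sub1 h) _; rewrite addr_ge0 ?mulr_ge0.
- by apply: mulr_ge0 (sub1 r) _; rewrite addr_ge0.
Qed.

Lemma open_jump_le (a b : R) : 0 <= a -> 0 <= b ->
  `|open_jump a| <= a + 2 * b.
Proof. by move=> a0 b0; rewrite ger0_norm /open_jump ?divr_ge0 //; lra. Qed.

Lemma close_jump_le (a b j : R) : 0 <= b -> 0 <= j -> j + 1 <= a ->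
  `|close_jump a b j| <= a + 2 * b.
Proof.
by move=> b0 j0 ja; rewrite ler_norml /close_jump; apply/andP; split; lra.
Qed.

Lemma var_open_le (a b : R) : 0 <= a -> 1 <= b ->
  `|var_cr (a + 1) (b - 1) - var_cr a b| <= (a + 2 * b) ^+ 2.
Proof.
by move=> a0 b1; rewrite ler_norml /var_cr; apply/andP; split; nra.
Qed.

Lemma var_close_le (a b : R) : 1 <= a -> 0 <= b ->
  `|var_cr (a - 1) b - var_cr a b| <= (a + 2 * b) ^+ 2.
Proof.
by move=> a1 b0; rewrite ler_norml /var_cr; apply/andP; split; nra.
Qed.

End Walk.

Import numFieldNormedType.Exports.
Local Open Scope classical_set_scope.

(** * The normal distribution function and the heat equation *)

Section NormalCdf.
Context {R : realType}.
Implicit Types x y z w t : R.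

Definition normal_cdf x : R := fine (normal_prob 0 1 `]-oo, x]%classic).
Definition std_pdf z : R := normal_peak 1 * expR (- z ^+ 2 / 2).

Lemma std_pdfE : normal_pdf 0 1 = std_pdf.
Proof.
apply/funext => x; rewrite normal_pdfE ?oner_eq0 //.
by rewrite /std_pdf /normal_fun subr0 expr1n.
Qed.

Lemma normal_cdfE x : (normal_cdf x)%:E = normal_prob 0 1 `]-oo, x]%classic.
Proof. by rewrite /normal_cdf fineK // fin_num_measure. Qed.

Lemma normal_cdf_ge0 x : 0 <= normal_cdf x.
Proof. by rewrite /normal_cdf fine_ge0. Qed.

Lemma normal_cdf_le1 x : normal_cdf x <= 1.
Proof. by rewrite -lee_fin normal_cdfE probability_le1. Qed.

Lemma normal_cdf_le x y : x <= y -> normal_cdf x <= normal_cdf y.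
Proof.
move=> xy; rewrite -lee_fin !normal_cdfE le_measure ?inE //.
exact: subitvPr.
Qed.

(** The fundamental theorem of calculus on a half-line. *)
Lemma is_derive_normal_cdf x : is_derive x 1 normal_cdf (std_pdf x).
Proof.
have xu : x < x + 1 by rewrite ltrDl.
have iT : lebesgue_measure.-integrable [set: R] (EFin \o std_pdf).
  by rewrite -std_pdfE; exact: integrable_normal_pdf.
have [||dF F'] := @continuous_FTC1 R std_pdf -oo%O x (x + 1) xu _ (ltNyr x).
- exact: integrableS iT.
- by rewrite -std_pdfE; apply: continuous_normal_pdf; exact: oner_neq0.
have FE : normal_cdf = fun y => (\int[lebesgue_measure]_(t in `]-oo, y]) std_pdf t)%R.
  by apply/funext => y; rewrite /normal_cdf /normal_prob std_pdfE.
rewrite FE; apply: DeriveDef; [exact: dF | by rewrite -derive1E F'].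
Qed.

Let idR : measurableTypeR R -> R := idfun.
#[local] HB.instance Definition _ :=
  @isMeasurableFun.Build _ _ _ _ idR (@measurable_id _ _ setT).

Lemma normal_cdf_tails (e : R) : 0 < e ->
  exists2 L, 0 < L & normal_cdf (- L) <= e /\ 1 - normal_cdf L <= e.
Proof.
move=> e0.
pose P : probability (measurableTypeR R) R := normal_prob 0 1.
pose X : {RV P >-> R} := idR.
have FE : normal_cdf = fine \o cdf X by apply/funext => y; rewrite /normal_cdf /=.
have H1 : normal_cdf y @[y --> +oo] --> (1 : R).
  by rewrite FE; have /fine_cvgP[_] := cvg_cdfy1 X.
have H2 : normal_cdf y @[y --> -oo] --> (0 : R).
  by rewrite FE; have /fine_cvgP[_] := cvg_cdfNy0 X.
have H2' : normal_cdf (- y) @[y --> +oo] --> (0 : R).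
  by move/cvgNy_compNP : H2.
have /cvgrPdist_le/(_ _ e0) N1 := H1.
have /cvgrPdist_le/(_ _ e0) N2 := H2'.
near (pinfty_nbhs R) => L; exists L => //; split.
  have : `|0 - normal_cdf (- L)| <= e by near: L.
  by rewrite sub0r normrN ger0_norm // normal_cdf_ge0.
have : `|1 - normal_cdf L| <= e by near: L.
by rewrite ger0_norm // subr_ge0 normal_cdf_le1.
Unshelve. all: by end_near. Qed.

Lemma is_derive_std_pdf z : is_derive z 1 std_pdf (- z * std_pdf z).
Proof.
rewrite /std_pdf; apply: trigger_derive.
by rewrite /GRing.scale /= ; field.
Qed.

(** [1 / sqrt w], written with [exp] and [ln] to be differentiated easily. *)
Definition rsqrt w : R := expR (- ln w / 2).

Lemma rsqrt_gt0 w : 0 < rsqrt w. Proof. exact: expR_gt0. Qed.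

Lemma rsqrt_sqr w : 0 < w -> rsqrt w ^+ 2 = w^-1.
Proof.
move=> w0; rewrite /rsqrt -expRM_natl -[RHS]lnK ?posrE ?invr_gt0 // lnV ?posrE //.
by congr expR; field.
Qed.

Lemma rsqrt_le w t : 0 < w -> w <= t -> rsqrt t <= rsqrt w.
Proof.
move=> w0 wt; rewrite /rsqrt ler_expR ler_pM2r ?invr_gt0 // lerN2 ler_ln ?posrE //.
exact: lt_le_trans wt.
Qed.

Lemma is_derive_rsqrt w : 0 < w -> is_derive w 1 rsqrt (- rsqrt w ^+ 3 / 2).
Proof.
move=> w0; rewrite /rsqrt; have dln := is_derive1_ln w0; apply: trigger_derive.
rewrite /GRing.scale /= -/(rsqrt w).
by rewrite (exprS (rsqrt w) 2) (rsqrt_sqr w0); field; exact: lt0r_neq0.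
Qed.

(** [heat y w = Phi (y / sqrt w)] and its first four derivatives in [y], namely
    [w^(-k/2)] times a Hermite function of [y / sqrt w].  The derivative in [w] is
    half the second derivative in [y]; this is [is_derive_heat_time]. *)
Definition heat y w := normal_cdf (y * rsqrt w).
Definition heat1 y w := rsqrt w * std_pdf (y * rsqrt w).
Definition heat2 y w := - (rsqrt w ^+ 2 * ((y * rsqrt w) * std_pdf (y * rsqrt w))).
Definition heat3 y w :=
  rsqrt w ^+ 3 * (((y * rsqrt w) ^+ 2 - 1) * std_pdf (y * rsqrt w)).
Definition heat4 y w :=
  rsqrt w ^+ 4 * ((3 * (y * rsqrt w) - (y * rsqrt w) ^+ 3) * std_pdf (y * rsqrt w)).

Lemma is_derive_mulr (s y : R) : is_derive y 1 (fun y => y * s) s.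
Proof.
rewrite -[X in is_derive _ _ _ X]mul1r.
by apply: trigger_derive; rewrite /GRing.scale /=; ring.
Qed.

Lemma is_derive_heat y w : is_derive y 1 (heat^~ w) (heat1 y w).
Proof.
have d1 := is_derive_mulr (rsqrt w) y.
have d2 := is_derive_normal_cdf (y * rsqrt w).
have := @is_derive1_comp _ normal_cdf (fun y => y * rsqrt w) y _ _ d2 d1.
by move/trigger_derive; apply; rewrite /heat1; ring.
Qed.

Lemma is_derive_std_pdf_scale y w : is_derive y 1 (fun y => std_pdf (y * rsqrt w))
   (- (y * rsqrt w) * std_pdf (y * rsqrt w) * rsqrt w).
Proof.
have d1 := is_derive_mulr (rsqrt w) y.
exact: (@is_derive1_comp _ std_pdf (fun y => y * rsqrt w) y _ _ (is_derive_std_pdf _) d1).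
Qed.

Lemma is_derive_heat1 y w : is_derive y 1 (heat1^~ w) (heat2 y w).
Proof.
have d1 := is_derive_std_pdf_scale y w.
by rewrite /heat1; apply: trigger_derive; rewrite /GRing.scale /heat2 /=; ring.
Qed.

Lemma is_derive_heat2 y w : is_derive y 1 (heat2^~ w) (heat3 y w).
Proof.
have d1 := is_derive_std_pdf_scale y w.
have d2 := is_derive_mulr (rsqrt w) y.
by rewrite /heat2; apply: trigger_derive; rewrite /GRing.scale /heat3 /=; ring.
Qed.

Lemma is_derive_heat_time y w : 0 < w -> is_derive w 1 (heat y) (heat2 y w / 2).
Proof.
move=> w0; have d1 := is_derive_rsqrt w0.
have d2 : is_derive w 1 (fun w => y * rsqrt w) (y * (- rsqrt w ^+ 3 / 2)).
  by apply: trigger_derive; rewrite /GRing.scale /=; ring.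
have := @is_derive1_comp _ normal_cdf (fun w => y * rsqrt w) w _ _
  (is_derive_normal_cdf _) d2.
by move/trigger_derive; apply; rewrite /heat2; field.
Qed.

Lemma is_derive_heat2_time y w : 0 < w ->
  is_derive w 1 (heat2 y) (heat4 y w / 2).
Proof.
move=> w0; have d1 := is_derive_rsqrt w0.
have d2 : is_derive w 1 (fun w => y * rsqrt w) (y * (- rsqrt w ^+ 3 / 2)).
  by apply: trigger_derive; rewrite /GRing.scale /=; ring.
have d3 : is_derive w 1 (fun w => std_pdf (y * rsqrt w)) _ :=
  @is_derive1_comp _ std_pdf (fun w => y * rsqrt w) w _ _ (is_derive_std_pdf _) d2.
by rewrite /heat2; apply: trigger_derive; rewrite /GRing.scale /heat4 /=; field.
Qed.

Lemma lipschitz_of_derive (f df : R -> R) (C x y : R) :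
  (forall t, (x <= t <= y) || (y <= t <= x) ->
     is_derive t 1 f (df t) /\ `|df t| <= C) ->
  `|f y - f x| <= C * `|y - x|.
Proof.
wlog xy : x y / x <= y => [W|H].
  have [/W//|/ltW yx] := leP x y => H.
  rewrite distrC [`|y - x|]distrC; apply: W => // t tyx.
  by apply: H; rewrite orbC.
have [t||t txy ->] := @MVT_segment R f df x y xy.
- by rewrite in_itv /= => /andP[xt ty]; apply: (H t _).1; rewrite (ltW xt) (ltW ty).
- apply: derivable_within_continuous => t; rewrite in_itv /= => txy.
  by have [|[]] := H t; rewrite ?txy.
rewrite normrM ler_wpM2r //; apply: (H t _).2.
by move: txy; rewrite in_itv /= => ->.
Qed.

Lemma between_dist (x y t : R) : (x <= t <= y) || (y <= t <= x) ->
  `|t - x| <= `|y - x|.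
Proof.
case/orP => /andP[? ?].
  by rewrite !ger0_norm ?subr_ge0 //; lra.
by rewrite !ler0_norm ?subr_le0 //; lra.
Qed.

(** The mean value theorem applied to [f] and then to [f1]; compared with the sharp
    constant this loses a factor 2. *)
Lemma taylor1 (f f1 f2 : R -> R) (C x y : R) :
  (forall t, (x <= t <= y) || (y <= t <= x) ->
    [/\ is_derive t 1 f (f1 t), is_derive t 1 f1 (f2 t) & `|f2 t| <= C]) ->
  `|f y - f x - (y - x) * f1 x| <= C * (y - x) ^+ 2.
Proof.
move=> H.
have -> : f y - f x - (y - x) * f1 x = (f y - y * f1 x) - (f x - x * f1 x) by ring.
have -> : C * (y - x) ^+ 2 = (C * `|y - x|) * `|y - x|.
  by rewrite -mulrA -expr2 real_normK // num_real.
apply: (@lipschitz_of_derive (fun t => f t - t * f1 x) (fun t => f1 t - f1 x)).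
move=> t tH; have [d1 d2 b2] := H t tH; split.
  by apply: trigger_derive; rewrite /GRing.scale /=; ring.
have C0 : 0 <= C by exact: le_trans b2.
apply: le_trans (_ : C * `|t - x| <= _); last first.
  by apply: ler_wpM2l => //; exact: between_dist.
apply: (@lipschitz_of_derive f1 f2) => u uH.
have [|//] := H u; move: tH uH.
by case/orP => /andP[? ?]; case/orP => /andP[? ?]; apply/orP;
  [left|left|right|right]; apply/andP; split; lra.
Qed.

Lemma taylor2 (f f1 f2 f3 : R -> R) (C x a : R) :
  (forall t, [/\ is_derive t 1 f (f1 t), is_derive t 1 f1 (f2 t),
    is_derive t 1 f2 (f3 t) & `|f3 t| <= C]) ->
  `|f (x + a) - f x - a * f1 x - a ^+ 2 / 2 * f2 x| <= C * `|a| ^+ 3.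
Proof.
move=> H.
have C0 : 0 <= C by have [_ _ _] := H 0; exact: le_trans.
pose g t := f t - t * f1 x - (t - x) ^+ 2 / 2 * f2 x.
have -> : f (x + a) - f x - a * f1 x - a ^+ 2 / 2 * f2 x = g (x + a) - g x.
  by rewrite /g; field.
have -> : C * `|a| ^+ 3 = (C * a ^+ 2) * `|(x + a) - x|.
  by rewrite addrAC subrr add0r -mulrA (exprSr `|a| 2) real_normK // num_real.
apply: (@lipschitz_of_derive g (fun t => f1 t - f1 x - (t - x) * f2 x)).
move=> t tH; have [d1 d2 d3 b3] := H t; split.
  by rewrite /g; apply: trigger_derive; rewrite /GRing.scale /=; field.
apply: le_trans (@taylor1 f1 f2 f3 C x t _) _.
  by move=> u _; have [] := H u.
apply: ler_wpM2l => //; rewrite -[leLHS]real_normK ?num_real //.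
rewrite -[leRHS]real_normK ?num_real // ler_sqr ?nnegrE //.
by have := between_dist tH; rewrite [x + a - x]addrAC subrr add0r.
Qed.

(** From [exp (z^2 / 4) >= 1 + z^2 / 4], squared. *)
Lemma std_pdf_poly_le (z p : R) : `|p| <= 16 * (1 + z ^+ 2 / 4) ^+ 2 ->
  `|p * std_pdf z| <= 16 * normal_peak 1.
Proof.
move=> pz; rewrite /std_pdf mulrCA normrM ger0_norm ?normal_peak_ge0 // mulrC.
apply: ler_wpM2r; first exact: normal_peak_ge0.
rewrite normrM [`|expR _|]gtr0_norm ?expR_gt0 //.
apply: le_trans (ler_wpM2r (expR_ge0 _) pz) _.
rewrite -mulrA ger_pMr //.
have -> : expR (- z ^+ 2 / 2) = expR (- (z ^+ 2 / 4)) ^+ 2.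
  by rewrite -expRM_natl; congr expR; field.
rewrite -exprMn expr_le1 ?mulr_ge0 ?expR_ge0 //; last first.
  by rewrite addr_ge0 // divr_ge0 // sqr_ge0.
apply: le_trans (ler_wpM2r (expR_ge0 _) (expR_ge1Dx _)) _.
by rewrite -expRD subrr expR0.
Qed.

(** The derivatives are bounded only because [w] stays away from 0; this is why
    the indicator has to be smoothed. *)
Lemma heat_bounds (w0 : R) : 0 < w0 -> exists2 K, 0 <= K &
  forall y w, w0 <= w -> `|heat3 y w| <= K /\ `|heat4 y w| <= K.
Proof.
move=> w00; pose s := rsqrt w0; have s0 : 0 < s := rsqrt_gt0 w0.
have p0 : 0 <= normal_peak (1 : R) := normal_peak_ge0 1.
exists ((s ^+ 3 + s ^+ 4) * (16 * normal_peak 1)).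
  by rewrite mulr_ge0 ?addr_ge0 ?exprn_ge0 ?mulr_ge0 // ltW.
move=> y w w0w; rewrite /heat3 /heat4; set z := y * rsqrt w.
have sw : rsqrt w <= s := rsqrt_le w00 w0w.
have sw0 := ltW (rsqrt_gt0 w).
have key k (p : R) : rsqrt w ^+ k <= s ^+ 3 + s ^+ 4 ->
    `|p| <= 16 * (1 + z ^+ 2 / 4) ^+ 2 ->
    `|rsqrt w ^+ k * (p * std_pdf z)| <= (s ^+ 3 + s ^+ 4) * (16 * normal_peak 1).
  move=> H1 H2; rewrite normrM ger0_norm ?exprn_ge0 //.
  by apply: ler_pM => //; [exact: exprn_ge0 | exact: std_pdf_poly_le].
have z2 : 0 <= z ^+ 2 := sqr_ge0 z.
have z4 : 0 <= z ^+ 4 by rewrite (exprM z 2 2) sqr_ge0.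
split; apply: key.
- by rewrite ler_wpDr ?exprn_ge0 ?(ltW s0) // lerXn2r ?nnegrE // ltW.
- by rewrite ler_norml; apply/andP; split; nra.
- by rewrite ler_wpDl ?exprn_ge0 ?(ltW s0) // lerXn2r ?nnegrE // ltW.
- rewrite ler_norml; have := sqr_ge0 (z - 1); have := sqr_ge0 (z + 1).
  have := sqr_ge0 (z ^+ 2 + z); have := sqr_ge0 (z ^+ 2 - z).
  by move=> *; apply/andP; split; nra.
Qed.

(** Second order expansion in [y] and first order in [w]: by the heat equation
    both corrections multiply the same derivative, so that for a centered [a]
    with [E a^2 = - b] the main terms vanish on average. *)
Lemma heat_step (w0 : R) : 0 < w0 -> exists2 K, 0 <= K &
  forall y w a b, w0 <= w -> w0 <= w + b ->
  `|heat (y + a) (w + b) - heat y w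
    - (a * heat1 y w + (a ^+ 2 + b) * (heat2 y w / 2))|
    <= K * (`|a| ^+ 3 + `|a| * `|b| + b ^+ 2).
Proof.
move=> w00; have [K K0 HK] := heat_bounds w00; exists K => // y w a b w0w w0b.
have T1 := @taylor2 (heat^~ w) (heat1^~ w) (heat2^~ w) (heat3^~ w) K y a _.
have {}T1 := T1 (fun t => And4 (is_derive_heat t w) (is_derive_heat1 t w)
  (is_derive_heat2 t w) (HK t w w0w).1).
have T2 : `|heat (y + a) (w + b) - heat (y + a) w - b * (heat2 (y + a) w / 2)|
    <= K * b ^+ 2.
  have -> : b = (w + b) - w by rewrite addrAC subrr add0r.
  rewrite [w + (_ - w)]addrC subrK.
  apply: (@taylor1 (heat (y + a)) (fun w => heat2 (y + a) w / 2)
    (fun w => heat4 (y + a) w / 4)) => t tw.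
  have w0t : w0 <= t by case/orP: tw => /andP[? ?]; lra.
  have t0 : 0 < t := lt_le_trans w00 w0t.
  split; first exact: is_derive_heat_time.
    have d := is_derive_heat2_time (y + a) t0.
    by apply: trigger_derive; rewrite /GRing.scale /=; field.
  have := (HK (y + a) t w0t).2; rewrite !ler_norml => /andP[? ?].
  by apply/andP; split; lra.
have T3 : `|heat2 (y + a) w - heat2 y w| <= K * `|a|.
  have := @lipschitz_of_derive (heat2^~ w) (heat3^~ w) K y (y + a).
  rewrite [_ + a - y]addrAC subrr add0r; apply => t _.
  by split; [exact: is_derive_heat2 | exact: (HK t w w0w).1].
have split_step A B C D E F : A - C - (a * D + (a ^+ 2 + b) * (E / 2)) =
    (B - C - a * D - a ^+ 2 / 2 * E) + (A - B - b * (F / 2)) + b / 2 * (F - E).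
  by field.
rewrite (split_step _ (heat (y + a) w) _ _ _ (heat2 (y + a) w)).
apply: le_trans (ler_normD _ _) _; apply: le_trans (lerD (ler_normD _ _) (lexx _)) _.
have T4 : `|b / 2 * (heat2 (y + a) w - heat2 y w)| <= K * (`|a| * `|b|).
  rewrite normrM [`|b / 2|]normrM (ger0_norm (_ : 0 <= 2^-1)) //.
  have H : 0 <= `|b| / 2 by rewrite divr_ge0.
  apply: le_trans (ler_wpM2l H T3) _.
  have : 0 <= K * (`|a| * `|b|) by rewrite !mulr_ge0.
  have -> : `|b| / 2 * (K * `|a|) = K * (`|a| * `|b|) / 2 by ring.
  by lra.
by apply: le_trans (lerD (lerD T1 T2) T4) _; rewrite -!mulrDr ler_wpM2l //; lra.
Qed.

End NormalCdf.

(** * Uniform matchings and the chain *)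

Section Uniform.
Context {R : realType}.
Variable n : nat.
Implicit Types (f : pair_partition n -> R) (g : nat -> R).

Definition avg f : R := (\sum_H f H) / #|{: pair_partition n}|%:R.

Lemma avg_le f1 f2 : (forall H, f1 H <= f2 H) -> avg f1 <= avg f2.
Proof. by move=> f12; rewrite ler_wpM2r ?invr_ge0 //; exact: ler_sum. Qed.

Lemma card_pair_partition_gt0 : (0 < #|{: pair_partition n}|)%N.
Proof. by apply/card_gt0P; exists point. Qed.

Lemma avgD_cst f (c : R) : avg (fun H => f H + c) = avg f + c.
Proof.
rewrite /avg big_split /= mulrDl sumr_const -[c *+ _]mulr_natr mulfK //.
by rewrite pnatr_eq0 -lt0n card_pair_partition_gt0.
Qed.

Lemma sum_crossings g : \sum_(H : pair_partition n) g (crossings H) =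
  completions R 0 n * chain_mean 0 (2 * n) g.
Proof.
rewrite -(crossing_sumE g (erefl : (0 + 2 * n)%N = (2 * n)%N)).
have := @sum_partial_matching (2 * n) R finset.set0 [set: 'I_(2 * n)]%SET g.
rewrite cards0 cardsT card_ord => <-; last by move=> a b; rewrite inE.
rewrite (reindex_omap (@blocks n) insub) /=; last first.
  move=> H mH; rewrite insubT /= //.
  move/partial_matchingP: mH => [pH hH]; apply/andP; split.
    by rewrite finset.set0U in pH.
  by apply/forallP => D; apply/implyP => /hH[->].
apply: eq_bigl => H; rewrite valK eqxx andbT; apply/esym.
apply/partial_matchingP; rewrite finset.set0U.
have /andP[pH /forallP hH] := valP H; split => // D DH.
have /implyP/(_ DH)/eqP D2 := hH D; split => //.
by rewrite finset.subset0 -cards_eq0 D2.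
Qed.

Lemma avg_crossings g : avg (fun H => g (crossings H)) = chain_mean 0 (2 * n) g.
Proof.
have cn1 : chain_mean 0 (2 * n) (fun=> 1) = 1 :> R.
  have := @chain_mean_jump R (fun _ _ => 1) (2 * n) 0 _ n 0 (leqnn _).
  rewrite mulr0 normr_le0 subr_eq0 => H; apply/eqP/H => h r y _ /=.
  by rewrite subrr mulr0 add0r big1 ?normr0 ?mulr0.
have c0 := lt0r_neq0 (completions_gt0 R 0 n).
have cardE : #|{: pair_partition n}|%:R = completions R 0 n.
  by have := sum_crossings (fun=> 1); rewrite sumr_const cn1 mulr1.
by rewrite /avg sum_crossings cardE mulrAC mulfV // mul1r.
Qed.

Lemma uniform_set1 (H : pair_partition n) :
  uniform_pair_partition R n [set H] = (#|{: pair_partition n}|%:R^-1)%:E.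
Proof.
rewrite (_ : [set H] = [set` [set H]%SET]); last first.
  by apply/seteqP; split => x /=; rewrite inE => /eqP.
by rewrite uniform_pair_partitionE cards1 mul1r.
Qed.

Lemma expectation_uniform f :
  ('E_(uniform_pair_partition R n)[f] = (avg f)%:E)%E.
Proof.
rewrite unlock.
transitivity (\int[uniform_pair_partition R n]_x
    (\sum_(H : pair_partition n) (f H)%:E * (\1_[set H] x)%:E))%E.
  apply: eq_integral => x _; rewrite (bigD1 x) //= big1 ?adde0 => [|H Hx].
    by rewrite indicE mem_set // mule1.
  by rewrite indicE memNset ?mule0 // => /= xH; rewrite xH eqxx in Hx.
rewrite integral_sum //; last first.
  by move=> H; apply: integrableZl => //; exact: integrable_indic.
have int1 (H : pair_partition n) :
    (\int[uniform_pair_partition R n]_x (\1_[set H] x)%:E =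
     (#|{: pair_partition n}|%:R^-1)%:E)%E.
  by rewrite integral_indic // setIT; exact: uniform_set1.
transitivity (\sum_(H : pair_partition n) (f H / #|{: pair_partition n}|%:R)%:E)%E.
  apply: eq_bigr => H _; rewrite integralZl //; last exact: integrable_indic.
  by rewrite int1 -EFinM.
by rewrite sumEFin /avg mulr_suml.
Qed.

Lemma prob_uniform (A : set (pair_partition n)) :
  uniform_pair_partition R n A = (avg \1_A)%:E.
Proof. by rewrite -expectation_uniform expectation_indic. Qed.

Lemma expectation_Cr :
  fine 'E_(uniform_pair_partition R n)[Cr R n]%E = mean_cr 0 n%:R.
Proof. by rewrite expectation_uniform /= avg_crossings chain_mean_id. Qed.

Lemma variance_Cr :
  fine (variance (uniform_pair_partition R n) (Cr R n)) = var_cr 0 n%:R.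
Proof.
rewrite /variance unlock expectation_Cr expectation_uniform /=.
transitivity (avg (fun H => ((crossings H)%:R - mean_cr 0 n%:R) ^+ 2)).
  by [].
rewrite (avg_crossings (fun k => (k%:R - mean_cr 0 n%:R) ^+ 2)).
by rewrite chain_mean_sqr subrr expr0n add0r.
Qed.

Definition std_cr (k : nat) : R :=
  (k%:R - mean_cr 0 n%:R) / Num.sqrt (var_cr 0 n%:R).

Lemma standardize_Cr H :
  standardize (uniform_pair_partition R n) (Cr R n) H = std_cr (crossings H).
Proof. by rewrite /standardize expectation_Cr variance_Cr. Qed.

Lemma cdf_Cr x :
  cdf (standardize (uniform_pair_partition R n) (Cr R n)
    : {RV uniform_pair_partition R n >-> R}) x =
  (avg (fun H => (std_cr (crossings H) <= x)%R%:R))%:E.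
Proof.
rewrite /cdf /distribution /= /pushforward prob_uniform; congr (avg _)%:E.
apply/funext => H; rewrite indicE /preimage /=; congr (nat_of_bool _)%:R.
apply/idP/idP => [/set_mem|Hx]; last apply/mem_set; rewrite /= in_itv /=.
  by rewrite standardize_Cr.
by rewrite standardize_Cr.
Qed.

End Uniform.

(** * Gaussian approximation *)

Section Limit.
Context {R : realType}.

(** All jumps of the prediction are at most [2n] and all jumps of the variance at
    most [(2n)^2], so after standardization they are bounded by [q] and [q^2] and
    [heat_step] bounds the error of each of the [2n] steps. *)
Lemma heat_gauss_approx (w0 : R) : 0 < w0 -> exists2 K, 0 <= K &
  forall n x, (0 < var_cr 0 n%:R :> R) ->
  let q := (2 * n)%:R / Num.sqrt (var_cr 0 n%:R) in
  `|chain_mean 0 (2 * n) (fun k => heat (x - std_cr n k) w0) - heat x (w0 + 1)|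
    <= (2 * n)%:R * (K * (2 * q ^+ 3 + q ^+ 4)).
Proof.
move=> w00; have [K K0 HK] := heat_step w00; exists K => // n x v0.
pose s := Num.sqrt (var_cr 0 n%:R : R); pose mu : R := mean_cr 0 n%:R.
pose q := (2 * n)%:R / s; rewrite /= -/s -/q.
have s0 : 0 < s by rewrite sqrtr_gt0.
have s2 : s ^+ 2 = var_cr 0 n%:R by rewrite sqr_sqrtr // ltW.
have s2i : 0 < s^-1 ^+ 2 by rewrite exprn_gt0 // invr_gt0.
pose f y w := heat (x - (y - mu) / s) (w0 + w / s ^+ 2).
have := @chain_mean_jump R f (2 * n) (K * (2 * q ^+ 3 + q ^+ 4)) _ n 0 (leqnn _).
rewrite /f /= add0r -/mu subrr !mul0r subr0 addr0 -s2 divff ?expf_neq0 ?lt0r_neq0 //.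
apply => h r y hr /=.
set a : R := h%:R; set b : R := r%:R.
pose w := w0 + var_cr a b / s ^+ 2; pose z := x - (y - mu) / s.
have q0 : 0 <= q by rewrite divr_ge0 // ltW.
have MM : a + 2 * b <= (2 * n)%:R.
  by rewrite /a /b -natrM -natrD ler_nat; case/andP: hr.
have a0 : 0 <= a by [].
have b0 : 0 <= b by [].
pose e := K * (2 * q ^+ 3 + q ^+ 4).
have step jump dv : `|jump| <= a + 2 * b -> `|dv| <= (a + 2 * b) ^+ 2 ->
    0 <= var_cr a b + dv ->
    `|heat (x - (y + jump - mu) / s) (w0 + (var_cr a b + dv) / s ^+ 2) - heat z w
      - (- jump / s * heat1 z w + (jump ^+ 2 + dv) * (heat2 z w / 2 / s ^+ 2))| <= e.
  move=> jM dM v'0.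
  have vab0 : 0 <= var_cr a b := var_cr_ge0 R h r.
  have := HK z w (- jump / s) (dv / s ^+ 2).
  have -> : z + - jump / s = x - (y + jump - mu) / s by rewrite /z; ring.
  have -> : w + dv / s ^+ 2 = w0 + (var_cr a b + dv) / s ^+ 2 by rewrite /w; ring.
  have -> : ((- jump / s) ^+ 2 + dv / s ^+ 2) * (heat2 z w / 2) =
    (jump ^+ 2 + dv) * (heat2 z w / 2 / s ^+ 2) by rewrite -exprVn; ring.
  move=> H; apply: le_trans (H _ _) _.
  - by rewrite /w lerDl divr_ge0 // exprn_ge0 // ltW.
  - by rewrite lerDl divr_ge0 // exprn_ge0 // ltW.
  apply: ler_wpM2l => //.
  have j1 : `|- jump / s| <= q.
    rewrite normrM normrN normfV (gtr0_norm s0) ler_pM2r ?invr_gt0 //.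
    exact: le_trans MM.
  have d1 : `|dv / s ^+ 2| <= q ^+ 2.
    rewrite normrM normfV (gtr0_norm (exprn_gt0 _ s0)) /q expr_div_n.
    rewrite ler_pM2r ?invr_gt0 ?exprn_gt0 //; apply: le_trans dM _.
    by rewrite lerXn2r ?nnegrE ?addr_ge0 ?mulr_ge0.
  have d2 : (dv / s ^+ 2) ^+ 2 <= q ^+ 4.
    rewrite -real_normK ?num_real // (exprM q 2 2).
    by rewrite lerXn2r ?nnegrE ?exprn_ge0.
  have j3 : `|- jump / s| ^+ 3 <= q ^+ 3 by rewrite lerXn2r ?nnegrE.
  have jd : `|- jump / s| * `|dv / s ^+ 2| <= q ^+ 3.
    by rewrite (exprS q 2) ler_pM.
  by rewrite mulr_natl mulr2n !lerD.
pose D jump dv := heat (x - (y + jump - mu) / s) (w0 + (var_cr a b + dv) / s ^+ 2) - heat z w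
      - (- jump / s * heat1 z w + (jump ^+ 2 + dv) * (heat2 z w / 2 / s ^+ 2)).
pose dvo := var_cr (a + 1) (b - 1) - var_cr a b.
pose dvc := var_cr (a - 1) b - var_cr a b.
rewrite [X in `|X|](_ : _ = 2 * b * D (open_jump a) dvo +
   \sum_(j < h) D (close_jump a b j%:R) dvc); last first.
  have var_o : var_cr a b + dvo = var_cr (a + 1) (b - 1) by rewrite addrC subrK.
  have var_c : var_cr a b + dvc = var_cr (a - 1) b by rewrite addrC subrK.
  pose C := \sum_(j < h) close_jump a b j%:R.
  pose V := \sum_(j < h) (close_jump a b j%:R ^+ 2 + dvc).
  have CE : C = - (2 * b * open_jump a) by apply/eqP; rewrite -addr_eq0 addrC jump_centered.
  have VE : V = - (2 * b * (open_jump a ^+ 2 + dvo)).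
    by apply/eqP; rewrite -addr_eq0 addrC jump_variance.
  have sumD : \sum_(j < h) D (close_jump a b j%:R) dvc =
      \sum_(j < h) (heat (x - (y + close_jump a b j%:R - mu) / s)
                        (w0 + var_cr (a - 1) b / s ^+ 2) - heat z w) -
      (- C * (heat1 z w / s) + V * (heat2 z w / 2 / s ^+ 2)).
    rewrite -sumrN !mulr_suml -big_split /= -sumrB; apply: eq_bigr => j _.
    rewrite /D var_c; congr (_ - (_ + _)); rewrite -[LHS]mulrA; congr (_ * _).
    exact: mulrC.
  rewrite sumD CE VE /D var_o -/z -/w.
  (* the main terms of the expansion add up to 0 by jump_centered and jump_variance *)
  have cancel A B h0 h1 h2 o v : 2 * b * (B - h0) + A =
      2 * b * (B - h0 - (- o / s * h1 + (o ^+ 2 + v) * h2)) +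
      (A - (- - (2 * b * o) * (h1 / s) + - (2 * b * (o ^+ 2 + v)) * h2)).
    by ring.
  exact: cancel.
apply: le_trans (ler_normD _ _) _.
have -> : (h + 2 * r)%:R * (K * (2 * q ^+ 3 + q ^+ 4)) = 2 * b * e + a * e.
  by rewrite natrD natrM -/a -/b -/e mulrDl addrC.
apply: lerD.
  rewrite normrM ger0_norm ?mulr_ge0 //.
  have [r0|r0] := posnP r.
    by rewrite (_ : 2 * b = 0) ?mul0r // /b r0 mulr0.
  have b1 : 1 <= b by rewrite ler1n.
  rewrite ler_wpM2l ?mulr_ge0 //; apply: step; [exact: open_jump_le| exact: var_open_le|].
  rewrite /dvo addrC subrK /a /b natr1 -(prednK r0) -(natr1 r.-1) addrK.
  exact: var_cr_ge0.
apply: le_trans (ler_norm_sum _ _ _) _; rewrite -/e -sum_ord_const.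
apply: ler_sum => j _.
have h0 : (0 < h)%N by have := ltn_ord j; lia.
have a1 : 1 <= a by rewrite ler1n.
apply: step; [apply: close_jump_le => //|exact: var_close_le|].
  by rewrite natr1 ler_nat.
rewrite /dvc addrC subrK /a -(prednK h0) -(natr1 h.-1) addrK.
exact: var_cr_ge0.
Qed.

Lemma var_cr0_ge (n : nat) : (2 <= n)%N -> n%:R ^+ 3 / 45 <= var_cr 0 n%:R :> R.
Proof.
move=> n2; have : 2 <= n%:R :> R by rewrite ler_nat.
by rewrite /var_cr; set a : R := n%:R => a2; nra.
Qed.

(** As [var_cr 0 n >= n^3 / 45], the quantity [q] is [O(n^(-1/2))] while
    [2n q^2 <= 360], so [2n (2 q^3 + q^4)] tends to 0. *)
Lemma heat_avg_cvg (w0 x d : R) : 0 < w0 -> 0 < d -> exists N, forall n, (N <= n)%N ->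
  `|chain_mean 0 (2 * n) (fun k => heat (x - std_cr n k) w0) - heat x (w0 + 1)| <= d.
Proof.
move=> w00 d0; have [K K0 HK] := heat_gauss_approx w00.
have K1 : 0 < 1080 * K + 1 by lra.
(* once q <= t, the total error is at most 360 K (2 t + t^2) <= 1080 K t *)
pose t := Num.min 1 (d / (1080 * K + 1)).
have t0 : 0 < t by rewrite lt_min ltr01 divr_gt0.
have t1 : t <= 1 by rewrite ge_min lexx.
have td : 1080 * K * t <= d.
  have : t <= d / (1080 * K + 1) by rewrite ge_min lexx orbT.
  by rewrite ler_pdivlMr // => H; nra.
exists (maxn 2 (Num.truncn (180 / t ^+ 2)).+1) => n; rewrite geq_max => /andP[n2 nN].
have nt : 180 <= n%:R * t ^+ 2.
  rewrite -ler_pdivrMr ?exprn_gt0 //; apply: ltW.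
  by apply: lt_le_trans (truncnS_gt _) _; rewrite ler_nat.
have nr2 : 2 <= n%:R :> R by rewrite ler_nat.
have v3 := var_cr0_ge n2.
set v : R := var_cr 0 n%:R in v3.
have v0 : 0 < v by apply: lt_le_trans v3; rewrite divr_gt0 // exprn_gt0 //; lra.
have := HK n x v0; rewrite /= -/v.
set s := Num.sqrt v; have s0 : 0 < s by rewrite sqrtr_gt0.
have s2 : s ^+ 2 = v by rewrite sqr_sqrtr // ltW.
set q := _ / s => H; apply: le_trans H _.
have q0 : 0 <= q by rewrite divr_ge0 // ltW.
have qs : q ^+ 2 * v = 4 * n%:R ^+ 2.
  by rewrite -s2 -exprMn /q divfK ?lt0r_neq0 // natrM; ring.
set m : R := n%:R in nt nr2 v3 qs *.
have m0 : 0 < m by lra.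
have qt : q <= t.
  rewrite -ler_sqr ?nnegrE ?(ltW t0) // -(ler_pM2r v0) qs.
  apply: le_trans (_ : t ^+ 2 * (m ^+ 3 / 45) <= _); last first.
    by rewrite ler_pM2l // exprn_gt0.
  have -> : t ^+ 2 * (m ^+ 3 / 45) = (m * t ^+ 2) * (m ^+ 2 / 45) by field.
  have -> : 4 * m ^+ 2 = 180 * (m ^+ 2 / 45) by field.
  by rewrite ler_pM2r // divr_gt0 // exprn_gt0.
have nq : 2 * m * q ^+ 2 <= 360.
  rewrite -(ler_pM2r v0) -[leLHS]mulrA qs.
  have -> : 2 * m * (4 * m ^+ 2) = 360 * (m ^+ 3 / 45) by field.
  exact: ler_wpM2l.
rewrite natrM -/m.
have -> : 2 * m * (K * (2 * q ^+ 3 + q ^+ 4)) = K * ((2 * m * q ^+ 2) * (2 * q + q ^+ 2)).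
  by ring.
apply: le_trans td; rewrite (_ : 1080 * K * t = K * (1080 * t)); last by ring.
rewrite ler_wpM2l //.
apply: le_trans (_ : 360 * (3 * t) <= _); last by lra.
apply: ler_pM => //.
- by rewrite mulr_ge0 ?sqr_ge0 // mulr_ge0 // ltW.
- by rewrite addr_ge0 ?sqr_ge0 // mulr_ge0.
- have : q ^+ 2 <= q * 1 by rewrite expr2 ler_wpM2l //; lra.
  by lra.
Qed.

Lemma heat_sqr (y e : R) : 0 < e -> heat y (e ^+ 2) = normal_cdf (y / e).
Proof.
move=> e0; rewrite /heat; congr (normal_cdf (y * _)).
apply/eqP; rewrite -(@eqrXn2 _ 2) //.
- by rewrite rsqrt_sqr ?exprn_gt0 // exprVn.
- exact/ltW/rsqrt_gt0.
- by rewrite invr_ge0 ltW.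
Qed.

(** If [X <= x], the argument of [Phi] is at least [L] once the smooth step has
    been shifted by [L * e]. *)
Lemma indicator_le_heat (X x L e : R) : 0 < e ->
  (X <= x)%R%:R <= heat (x + L * e - X) (e ^+ 2) + (1 - normal_cdf L).
Proof.
move=> e0; rewrite heat_sqr //; case: (leP X x) => Xx.
  have : normal_cdf L <= normal_cdf ((x + L * e - X) / e).
    by apply: normal_cdf_le; rewrite ler_pdivlMr //; lra.
  by rewrite /=; lra.
have := normal_cdf_ge0 ((x + L * e - X) / e); have := normal_cdf_le1 L.
by rewrite /=; lra.
Qed.

Lemma heat_le_indicator (X x L e : R) : 0 < e ->
  heat (x - L * e - X) (e ^+ 2) - normal_cdf (- L) <= (X <= x)%R%:R.
Proof.
move=> e0; rewrite heat_sqr //; case: (leP X x) => Xx.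
  have := normal_cdf_le1 ((x - L * e - X) / e).
  have := normal_cdf_ge0 (- L); rewrite /=; lra.
have : normal_cdf ((x - L * e - X) / e) <= normal_cdf (- L).
  by apply: normal_cdf_le; rewrite ler_pdivrMr //; lra.
by rewrite /=; lra.
Qed.

Lemma normal_cdf_lipschitz (x y : R) :
  `|normal_cdf y - normal_cdf x| <= normal_peak 1 * `|y - x|.
Proof.
apply: (lipschitz_of_derive (df := std_pdf)) => t _; split.
  exact: is_derive_normal_cdf.
rewrite /std_pdf ger0_norm ?mulr_ge0 ?normal_peak_ge0 ?expR_ge0 //.
rewrite ler_piMr ?normal_peak_ge0 // -[leRHS]expR0 ler_expR.
by rewrite mulNr oppr_le0 divr_ge0 // sqr_ge0.
Qed.

(** Smoothing by [e] and shifting by [c] perturb the limit little: [Phi] is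
    Lipschitz and [1 - (1 + e^2)^(-1/2) <= e]. *)
Lemma heat_near (x c e : R) : 0 < e <= 1 ->
  `|heat (x + c) (e ^+ 2 + 1) - normal_cdf x| <= normal_peak 1 * (`|x| * e + `|c|).
Proof.
case/andP=> e0 e1; apply: le_trans (normal_cdf_lipschitz _ _) _.
apply: ler_wpM2l; first exact: normal_peak_ge0.
set s := rsqrt _.
have s0 : 0 < s := rsqrt_gt0 _.
have e2 : 0 < e ^+ 2 by rewrite exprn_gt0.
have w0 : 0 < e ^+ 2 + 1 by rewrite addr_gt0.
have s2 : s ^+ 2 * (e ^+ 2 + 1) = 1 by rewrite rsqrt_sqr // mulVf ?lt0r_neq0.
have s1 : s <= 1.
  by rewrite -(@expr_le1 _ 2) ?(ltW s0) // rsqrt_sqr // invf_le1 // lerDr ltW.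
have se : 1 - s <= e.
  have h1 : s ^+ 2 <= s by rewrite expr2 ger_pMr.
  have h2 : s ^+ 2 * e ^+ 2 <= e ^+ 2.
    by rewrite ger_pMl // expr_le1 // ltW.
  have h3 : e ^+ 2 <= e by rewrite expr2 ger_pMr.
  rewrite mulrDr mulr1 in s2; lra.
have -> : (x + c) * s - x = - (x * (1 - s)) + c * s by ring.
apply: le_trans (ler_normD _ _) _; rewrite normrN !normrM.
rewrite [`|1 - s|]ger0_norm ?subr_ge0 // [`|s|]gtr0_norm //.
by apply: lerD; [exact: ler_wpM2l|exact: ler_piMr].
Qed.

End Limit.

Theorem theorem6p5 (R : realType) :
  cvg_in_distribution (uniform_pair_partition R)
    (fun n : nat => standardize (uniform_pair_partition R n) (Cr R n))
    (normal_prob 0%R 1%R).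
Proof.
move=> x _; rewrite -[X in _ --> X](normal_cdfE x).
pose F n : R := avg (fun H : pair_partition n => (std_cr n (crossings H) <= x)%R%:R).
rewrite [X in X @ _ --> _](_ : _ = fun n => (F n)%:E); last first.
  by apply/funext => n; exact: cdf_Cr.
apply: cvg_EFin; first by near=> n.
apply/cvgrPdist_le => /= d d0.
have d3 : 0 < d / 3 by rewrite divr_gt0.
have [L L0 [tail1 tail2]] := normal_cdf_tails d3.
have p0 := normal_peak_ge0 (1 : R).
pose M := normal_peak 1 * (`|x| + L) + 1.
have M0 : 0 < M by rewrite ltr_wpDl // mulr_ge0 // addr_ge0 // ltW.
(* the smoothing scale: it makes the bound of heat_near at most d / 3 *)
pose e := Num.min 1 (d / 3 / M).
have e0 : 0 < e by rewrite lt_min ltr01 divr_gt0.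
have e01 : 0 < e <= 1 by rewrite e0 ge_min lexx.
have eM : normal_peak 1 * (`|x| * e + L * e) <= d / 3.
  have : e <= d / 3 / M by rewrite ge_min lexx orbT.
  rewrite ler_pdivlMr // /M mulrDr mulr1 -mulrDl mulrCA => ?; rewrite mulrC; lra.
have e2 : 0 < e ^+ 2 by rewrite exprn_gt0.
have [N1 H1] := heat_avg_cvg (x + L * e) e2 d3.
have [N2 H2] := heat_avg_cvg (x - L * e) e2 d3.
near=> n.
have nN1 : (N1 <= n)%N by near: n; exact: nbhs_infty_ge.
have nN2 : (N2 <= n)%N by near: n; exact: nbhs_infty_ge.
have Le : `|L * e| = L * e by rewrite ger0_norm // mulr_ge0 // ltW.
have := H1 n nN1; have := H2 n nN2.
have := heat_near x (L * e) e01; have := heat_near x (- (L * e)) e01.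
rewrite normrN Le -!(avg_crossings n (fun k => heat _ _)).
set h1 := heat (x + L * e) _; set h2 := heat (x - L * e) _.
set A1 := avg _; set A2 := avg _.
have F1 : F n <= A2 + (1 - normal_cdf L).
  by rewrite -avgD_cst; apply: avg_le => H; exact: indicator_le_heat.
have F2 : A1 - normal_cdf (- L) <= F n.
  by rewrite -avgD_cst; apply: avg_le => H; exact: heat_le_indicator.
rewrite !ler_norml => /andP[? ?] /andP[? ?] /andP[? ?] /andP[? ?].
by lra.
Unshelve. all: by end_near. Qed.
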